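(* Let $R=\mathbb{Z}[\sqrt5]$, with field of fractions $F=\mathbb{Q}[\sqrt5]$. Let $n=2$ and set $$g=\Bigl(X-\tfrac{1-\sqrt5}{2}\Bigr)\Bigl(X-\tfrac{1+\sqrt5}{2}\Bigr)=X^2-X-1\in R[X],$$ $$f=\Bigl(X-\tfrac{1-\sqrt5}{2}\Bigr)\Bigl(X-\tfrac{5+\sqrt5}{2}\Bigr)=X^2-3X-\sqrt5\in R[X],$$ and let $C,D\in M_2(R)$ be the companion matrices of $f$ and $g$, respectively. Then the subalgebra $R\langle C,D\rangle$ of $M_2(R)$ is not a free $R$-module.
   Context: The companion matrix of $X^2+f_1X+f_0$ is $\begin{pmatrix}0&-f_0\\1&-f_1\end{pmatrix}$; thus $C=\begin{pmatrix}0&\sqrt5\\1&3\end{pmatrix}$ and $D=\begin{pmatrix}0&1\\1&1\end{pmatrix}$. $R\langle C,D\rangle$ is the unital $R$-subalgebra of $M_2(R)$ generated by $C$ and $D$. *)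

(* Defs.v *)
From HB Require Import structures.
From mathcomp Require Import all_boot all_order all_algebra all_field.
From mathcomp Require Import ring.
From mathcomp Require Import boolp classical_sets.

Set Implicit Arguments.
Unset Strict Implicit.
Unset Printing Implicit Defensive.

Import Order.TTheory GRing.Theory Num.Theory.
Local Open Scope ring_scope.

(* Z[sqrt 5], as the subring {a + b sqrt 5 | a, b in Z} of algC. *)
Definition Zsqrt5_pred : {pred algC} := Cint_span [:: 1; sqrtC 5].

Lemma Zsqrt5_predP (x : algC) :
  reflect (exists a b : int, x = a%:~R + b%:~R * sqrtC 5) (x \in Zsqrt5_pred).
Proof.
apply: (iffP (Cint_spanP [tuple 1; sqrtC 5] x)) => [[a ->]|[a [b ->]]].
  exists (a 0), (a (lift 0 0)).
  by rewrite !big_ord_recl big_ord0 addr0 /= mulrzl.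
exists [ffun i : 'I_2 => if i == 0 then a else b].
by rewrite !big_ord_recl big_ord0 addr0 /= !ffunE /= mulrzl.
Qed.

Fact Zsqrt5_subring_closed : subring_closed Zsqrt5_pred.
Proof.
have sq5 : sqrtC 5 ^+ 2 = 5 :> algC by rewrite sqrtCK.
split=> [|x y /Zsqrt5_predP[a [b ->]] /Zsqrt5_predP[c [d ->]]
         |x y /Zsqrt5_predP[a [b ->]] /Zsqrt5_predP[c [d ->]]];
  apply/Zsqrt5_predP.
- by exists 1, 0; rewrite mul0r addr0.
- by exists (a - c), (b - d); ring.
- by exists (a * c + 5 * (b * d)), (a * d + b * c); ring: sq5.
Qed.

HB.instance Definition _ :=
  GRing.isSubringClosed.Build algC Zsqrt5_pred Zsqrt5_subring_closed.

Record Zsqrt5 := MkZsqrt5 { Zsqrt5_val : algC; _ : Zsqrt5_val \in Zsqrt5_pred }.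

HB.instance Definition _ := [isSub for Zsqrt5_val].
HB.instance Definition _ := [Choice of Zsqrt5 by <:].
HB.instance Definition _ := [SubChoice_isSubComNzRing of Zsqrt5 by <:].

(* The instances below make Zsqrt5 an integral domain, as required by
   {fraction Zsqrt5}: x is a unit iff its inverse in algC lies in Zsqrt5. *)
Definition Zsqrt5_unit : {pred Zsqrt5} :=
  [pred x | (x != 0) && ((val x)^-1 \in Zsqrt5_pred)].

Definition Zsqrt5_inv (x : Zsqrt5) : Zsqrt5 :=
  if x \in Zsqrt5_unit then insubd x (val x)^-1 else x.

Fact Zsqrt5_mulVx : {in Zsqrt5_unit, left_inverse 1 Zsqrt5_inv *%R}.
Proof.
move=> x Ux; rewrite /Zsqrt5_inv Ux; have /andP[x0 Vx] := Ux.
by apply: val_inj; rewrite rmorphM /= insubdK // mulVf // (inj_eq val_inj _ 0).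
Qed.

Fact Zsqrt5_unitPl (x y : Zsqrt5) : y * x = 1 -> Zsqrt5_unit x.
Proof.
move=> yx1; have x0 : x != 0.
  by apply: contra_eq_neq yx1 => ->; rewrite mulr0 eq_sym oner_neq0.
have vx0 : val x != 0 by rewrite (inj_eq val_inj _ 0).
have /(congr1 val) := yx1; rewrite rmorphM /= => vyx.
rewrite /Zsqrt5_unit /= x0 /=; suff -> : (Zsqrt5_val x)^-1 = val y by apply: valP.
by apply: (mulIf vx0); rewrite mulVf.
Qed.

Fact Zsqrt5_inv_out : {in [predC Zsqrt5_unit], Zsqrt5_inv =1 id}.
Proof. by move=> x; rewrite inE /Zsqrt5_inv => /negbTE ->. Qed.

HB.instance Definition _ := GRing.ComNzRing_hasMulInverse.Build Zsqrt5
  Zsqrt5_mulVx Zsqrt5_unitPl Zsqrt5_inv_out.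

Fact Zsqrt5_integral : GRing.integral_domain_axiom Zsqrt5.
Proof.
move=> x y /(congr1 val) /eqP; rewrite rmorphM mulf_eq0.
by rewrite !(inj_eq val_inj _ 0).
Qed.

HB.instance Definition _ :=
  GRing.ComUnitRing_isIntegral.Build Zsqrt5 Zsqrt5_integral.

Fact sqrt5_subproof : sqrtC 5 \in Zsqrt5_pred.
Proof. by apply/Zsqrt5_predP; exists 0, 1; rewrite add0r mul1r. Qed.

Definition sqrt5 : Zsqrt5 := MkZsqrt5 sqrt5_subproof.

Local Notation tofrac := (@FracField.tofrac _).
Local Notation "x %:F" := (tofrac x).

(* The field of fractions {fraction Zsqrt5} is Q[sqrt 5]. *)
Lemma frac_Zsqrt5P (z : {fraction Zsqrt5}) :
  exists a b d : int,
    d%:~R != 0 :> {fraction Zsqrt5} /\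
    z = (a%:~R + b%:~R * sqrt5%:F) / d%:~R.
Proof.
have repr_int (x : Zsqrt5) : exists a b : int, x = a%:~R + b%:~R * sqrt5.
  have /Zsqrt5_predP[a [b xE]] := valP x; exists a, b; apply: val_inj.
  by rewrite xE -!(rmorph_int (val : Zsqrt5 -> algC)) rmorphD rmorphM.
have sq5 : sqrt5 ^+ 2 = 5.
  by apply: val_inj; rewrite rmorphXn -[RHS]/(val 5%:R) rmorph_nat /= sqrtCK.
have [n [m [m0 ->]]] : exists n m : Zsqrt5, m != 0 /\ z = n%:F / m%:F.
  elim/quotW: z => r; exists r.1, r.2; split; first exact: denom_ratioP.
  have d0 : r.2%:F != 0 :> {fraction Zsqrt5}.
    by rewrite tofrac_eq0 denom_ratioP.
  apply: (mulIf d0); rewrite divfK //; unlock FracField.tofrac.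
  rewrite -[LHS]FracField.pi_mul; apply/eqmodP; rewrite /= FracField.equivfE.
  rewrite /FracField.mulf !numden_Ratio ?mulf_neq0 ?denom_ratioP ?oner_neq0 //.
  by rewrite !mulr1 mulrC.
have [a [b nE]] := repr_int n; have [c [d mE]] := repr_int m.
have norm_m (m' : Zsqrt5) (N p q : int) : m' != 0 -> m * m' = N%:~R ->
    n * m' = p%:~R + q%:~R * sqrt5 ->
  exists a b d : int, d%:~R != 0 :> {fraction Zsqrt5} /\
    n%:F / m%:F = (a%:~R + b%:~R * sqrt5%:F) / d%:~R.
  move=> m'0 mN nN; exists p, q, N.
  have intF (k : int) : k%:~R = (k%:~R : Zsqrt5)%:F by rewrite rmorph_int.
  rewrite !intF -rmorphM -rmorphD /= -mN -nN !rmorphM /=.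
  split; first by rewrite mulf_neq0 ?tofrac_eq0.
  by rewrite -mulf_div divff ?mulr1 ?tofrac_eq0.
have [cd0|cd0] := eqVneq (c%:~R - d%:~R * sqrt5) 0.
  apply: (norm_m 1 (2 * c) a b); rewrite ?oner_neq0 ?mulr1 // mE.
  by rewrite -[LHS]addr0 -cd0; ring.
apply: (norm_m _ (c ^+ 2 - 5 * d ^+ 2) (a * c - 5 * (b * d)) (b * c - a * d) cd0).
  by rewrite mE; ring: sq5.
by rewrite nE; ring: sq5.
Qed.

(* Companion matrix of a monic p of degree n, with the coefficients of p in the
   last column; companionmx from mxpoly has them in the last row instead. *)
Definition companion (R : nzRingType) (n : nat) (p : {poly R}) : 'M[R]_n :=
  \matrix_(i < n, j < n)
    if j == n.-1 :> nat then - p`_i else (i == j.+1 :> nat)%:R.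

Definition gen_subalg (R : comNzRingType) (A : algType R) (X : set A) : set A :=
  smallest (fun S : set A => GRing.subalg_closed (fun x => x \in S)) X.

(* B is a basis, of arbitrary cardinality, of the submodule S of V. *)
Definition is_basis (R : nzRingType) (V : lmodType R) (S B : set V) : Prop :=
  [/\ (forall b, B b -> S b),
      (forall x, S x -> exists (s : seq V) (c : V -> R),
         (forall b, b \in s -> B b) /\ x = \sum_(b <- s) c b *: b) &
      (forall (s : seq V) (c : V -> R),
         uniq s -> (forall b, b \in s -> B b) ->
         \sum_(b <- s) c b *: b = 0 -> forall b, b \in s -> c b = 0)].

Definition free_submodule (R : nzRingType) (V : lmodType R) (S : set V) : Prop :=
  exists B : set V, is_basis S B.

(* Main.v *)
Require Import Defs.
From HB Require Import structures.
From mathcomp Require Import all_boot all_order all_algebra all_field.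
From mathcomp Require Import ring zify.
From mathcomp Require Import boolp classical_sets.

Set Implicit Arguments.
Unset Strict Implicit.
Unset Printing Implicit Defensive.

Import GRing.Theory Num.Theory.
Local Open Scope classical_set_scope.
Local Open Scope ring_scope.

(** Write s for sqrt5, R for Z[s], A for the algebra R<C, D>, E = C - D, and P
for the ideal (2, 1 + s), which is proper and satisfies P^2 = 2 P. Then A is
spanned by 1, D, E and D E, where (s + 1) E = 2 D E; it is the direct sum of
R 1, R D and a copy R E + R D E of P, and P is not projective.
The argument below makes the obstruction explicit.

Suppose that A has a basis. Comparing coordinates in (s + 1) E = 2 D E, every
coordinate w of E satisfies (s + 1) w = 2 v for some v in R, whence w lies in P
([basis_common_ratio], [in_P_ratio]): thus E belongs to P A. On the other hand,
the linear form m(X) = X11 - X00 - X10 takes values in P on A, because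
the matrices x + y D + p E + q D E are closed under multiplication
([ED_span_subalg]). Hence m(E) = 2 lies in P P = 2 P ([in_P_mul]), so 1 lies in
P, which is false ([one_notin_P]). *)

(** * Arithmetic of Z[sqrt5] *)

Lemma sqrt5_sq : sqrt5 ^+ 2 = 5.
Proof. by apply: val_inj; rewrite rmorphXn -[RHS]/(val 5%:R) rmorph_nat /= sqrtCK. Qed.

Lemma Zsqrt5_repr (x : Zsqrt5) : exists a b : int, x = a%:~R + b%:~R * sqrt5.
Proof.
have /Zsqrt5_predP[a [b xE]] := valP x; exists a, b; apply: val_inj.
by rewrite xE -!(rmorph_int (val : Zsqrt5 -> algC)) rmorphD rmorphM.
Qed.

(** Irrationality of the square root of 5, by parity of the 5-adic valuation. *)
Lemma sqr_eq_5sqr (a b : int) : a ^+ 2 = 5 * b ^+ 2 -> b = 0.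
Proof.
move=> /(congr1 absz); rewrite abszM !abszX => e.
apply/eqP; rewrite -absz_eq0 -leqn0 leqNgt; apply/negP => b0.
have a0 : (0 < `|a|)%N.
  have : (0 < `|a| ^ 2)%N by rewrite e muln_gt0 expn_gt0 b0.
  by rewrite expn_gt0 orbF.
have /(congr1 odd) := congr1 (logn 5) e.
by rewrite lognM ?expn_gt0 ?b0 // !lognX oddD !oddM.
Qed.

Lemma Zsqrt5_int_inj (a b : int) : (a%:~R : Zsqrt5) = b%:~R -> a = b.
Proof.
move=> /(congr1 val); rewrite !(rmorph_int (val : Zsqrt5 -> algC)).
exact: intr_inj.
Qed.

Lemma Zsqrt5_coord_inj (a b c d : int) :
  a%:~R + b%:~R * sqrt5 = c%:~R + d%:~R * sqrt5 -> a = c /\ b = d.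
Proof.
move=> e.
have e1 : (a - c)%:~R = (d - b)%:~R * sqrt5.
  by apply/eqP; rewrite -subr_eq0 -(subrr (a%:~R + b%:~R * sqrt5)) {2}e; apply/eqP; ring.
have db : d - b = 0.
  apply: (@sqr_eq_5sqr (a - c)); apply: Zsqrt5_int_inj.
  by rewrite rmorphXn /= e1 exprMn sqrt5_sq rmorphM rmorphXn /= mulrC.
by move: e1; rewrite db mul0r => /(@Zsqrt5_int_inj _ 0); lia.
Qed.

(** The ideal generated by 2 and 1 + sqrt5. *)
Definition in_P (x : Zsqrt5) : Prop := exists p q, x = 2 * p + (sqrt5 + 1) * q.

Lemma one_notin_P : ~ in_P 1.
Proof.
case=> p [q]; have [a [b ->]] := Zsqrt5_repr p; have [c [d ->]] := Zsqrt5_repr q.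
move=> e; have [] : 1%Z = 2 * a + c + 5 * d /\ 0%Z = 2 * b + c + d; last by lia.
by apply: Zsqrt5_coord_inj; rewrite mul0r addr0 [LHS]e; ring: sqrt5_sq.
Qed.

(** The ideal quotient (2 : 1 + sqrt5) is contained in P: if w = a + b sqrt5,
then a and b have the same parity. *)
Lemma in_P_ratio (w v : Zsqrt5) : (sqrt5 + 1) * w = 2 * v -> in_P w.
Proof.
have [a [b ->]] := Zsqrt5_repr w; have [c [d ->]] := Zsqrt5_repr v.
move=> e; have [e1 e2] : a + 5 * b = 2 * c /\ a + b = 2 * d.
  apply: Zsqrt5_coord_inj; transitivity (2 * (c%:~R + d%:~R * sqrt5)); last by ring.
  by rewrite -e; ring: sqrt5_sq.
exists (d - b)%:~R, b%:~R.
have -> : a = 2 * d - b by lia.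
by ring.
Qed.

(** The product of two elements of P lies in 2 P; since P is proper, this prevents
P from being invertible. *)
Lemma in_P_mul (w v : Zsqrt5) : in_P w -> in_P v -> exists2 u, in_P u & w * v = 2 * u.
Proof.
move=> [p [q ->]] [p' [q' ->]].
exists (2 * (p * p' + q * q') + (sqrt5 + 1) * (p * q' + q * p' + q * q')).
  by exists (p * p' + q * q'), (p * q' + q * p' + q * q').
by ring: sqrt5_sq.
Qed.

(** * Coordinates in a basis *)

(** A linear combination over a list with repetitions, rewritten over a
duplicate-free list that contains it. *)
Lemma lincomb_collect (R : nzRingType) (V : lmodType R) (s t : seq V) (c : V -> R) :
  uniq t -> {subset s <= t} ->
  exists c' : V -> R, \sum_(b <- s) c b *: b = \sum_(b <- t) c' b *: b.
Proof.
move=> ut st; exists (fun b => \sum_(a <- s | a == b) c a).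
under [RHS]eq_bigr do rewrite scaler_suml.
rewrite (exchange_big_dep predT) //= !big_seq; apply: eq_bigr => a /st ta.
under eq_bigl do rewrite eq_sym.
by rewrite -big_filter filter_pred1_uniq // big_seq1.
Qed.

(** A relation k x = l y holds coordinatewise in a basis. *)
Lemma basis_common_ratio (R : nzRingType) (V : lmodType R) (S B : set V) (x y : V)
    (k l : R) :
  is_basis S B -> S x -> S y -> k *: x = l *: y ->
  exists (s : seq V) (w v : V -> R),
    [/\ forall b, b \in s -> S b, x = \sum_(b <- s) w b *: b &
        forall b, b \in s -> k * w b = l * v b].
Proof.
move=> [BS span indep] /span[s1 [c1 [B1 ->]]] /span[s2 [c2 [B2 ->]]].
set s := undup (s1 ++ s2); have us : uniq s by apply: undup_uniq.
have sB b : b \in s -> B b.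
  by rewrite mem_undup mem_cat => /orP[/B1|/B2].
have [|w ->] := @lincomb_collect _ _ s1 s c1 us.
  by move=> b b1; rewrite mem_undup mem_cat b1.
have [|v ->] := @lincomb_collect _ _ s2 s c2 us.
  by move=> b b2; rewrite mem_undup mem_cat b2 orbT.
move=> e; exists s, w, v; split=> // [b /sB/BS //|b bs].
apply/eqP; rewrite -subr_eq0; apply/eqP.
apply: (indep s (fun b => k * w b - l * v b)) => //.
under eq_bigr do rewrite scalerBl -!scalerA.
by rewrite sumrB -!scaler_sumr e subrr.
Qed.

(** * The subalgebra *)

Local Notation M2 := 'M[Zsqrt5]_2.

(** The matrices x + y D + p E + q D E, where D has rows (0, 1) and (1, 1), E has
rows (0, sqrt5 - 1) and (0, 2), and D E has rows (0, 2) and (0, sqrt5 + 1). The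
coefficients x and y are the entries of the first column, so the condition
concerns the second column only. *)
Definition ED_span (X : M2) : Prop := exists p q,
  X 0 1 = X 1 0 + (sqrt5 - 1) * p + 2 * q /\
  X 1 1 = X 0 0 + X 1 0 + 2 * p + (sqrt5 + 1) * q.

Lemma mulmx2E (R : pzSemiRingType) (X Y : 'M[R]_2) i j :
  (X *m Y) i j = X i 0 * Y 0 j + X i 1 * Y 1 j.
Proof.
rewrite mxE !big_ord_recl big_ord0 addr0.
by have -> : lift ord0 ord0 = 1 :> 'I_2 by apply: val_inj.
Qed.

Lemma ED_span_subalg :
  GRing.subalg_closed (fun X : M2 => X \in [set X | ED_span X]).
Proof.
split=> [|k X Y|X Y]; rewrite !in_setE.
- by exists 0, 0; rewrite !mxE /=; split; ring.
- move=> [p [q [X01 X11]]] [p' [q' [Y01 Y11]]]; exists (k * p + p'), (k * q + q').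
  by rewrite !mxE X01 X11 Y01 Y11; split; ring.
- move=> [p [q [X01 X11]]] [p' [q' [Y01 Y11]]].
  set x := X 0 0 in X01 X11 *; set y := X 1 0 in X01 X11 *.
  set x' := Y 0 0 in Y01 Y11 *; set y' := Y 1 0 in Y01 Y11 *.
  (* Besides D^2 = D + 1, the products are reduced by E^2 = 2 E,
     E D = E + 2 D + (sqrt5 - 1) - D E and E D E = (sqrt5 + 1) E. *)
  exists (x * p' + y * q' + p * (x' + y') - q * y' + (2 * p' + (sqrt5 + 1) * q') * p),
    (x * q' + y * p' + y * q' + q * x' - p * y' + (2 * p' + (sqrt5 + 1) * q') * q).
  rewrite -mulmxE !mulmx2E X01 X11 Y01 Y11 -/x -/y -/x' -/y'.
  by split; ring: sqrt5_sq.
Qed.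

Theorem mainTheorem8 :
  let toF : Zsqrt5 -> {fraction Zsqrt5} := @FracField.tofrac Zsqrt5 in
  let r5 : {fraction Zsqrt5} := toF sqrt5 in
  let g : {poly Zsqrt5} := 'X^2 - 'X - 1 in
  let f : {poly Zsqrt5} := 'X^2 - 3%:R *: 'X - sqrt5%:P in
  let C : 'M[Zsqrt5]_2 := companion 2 f in
  let D : 'M[Zsqrt5]_2 := companion 2 g in
  [/\ map_poly toF g
        = ('X - ((1 - r5) / 2%:R)%:P) * ('X - ((1 + r5) / 2%:R)%:P),
      map_poly toF f
        = ('X - ((1 - r5) / 2%:R)%:P) * ('X - ((5%:R + r5) / 2%:R)%:P) &
      ~ free_submodule (gen_subalg [set C; D])].
Proof.
move=> toF r5 g f C D.
have r5sq : r5 ^+ 2 = 5 by rewrite /r5 -rmorphXn sqrt5_sq rmorph_nat.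
have two0 : 2 != 0 :> {fraction Zsqrt5}.
  rewrite -(rmorph_nat toF 2) tofrac_eq0; apply/eqP => e.
  by have /Zsqrt5_int_inj : 2%:~R = 0%:~R :> Zsqrt5.
have quad (u v : {fraction Zsqrt5}) :
    ('X - u%:P) * ('X - v%:P) = 'X^2 - (u + v)%:P * 'X + (u * v)%:P.
  by rewrite polyCD polyCM; ring.
have entC : [/\ C 0 0 = 0, C 0 1 = sqrt5, C 1 0 = 1 & C 1 1 = 3].
  rewrite !mxE /= !(coefB, coefZ, coefX, coefXn, coefC) /=.
  by split; ring.
have entD : [/\ D 0 0 = 0, D 0 1 = 1, D 1 0 = 1 & D 1 1 = 1].
  rewrite !mxE /= !(coefB, coefZ, coefX, coefXn, coef1) /=.
  by split; ring.
split.
- rewrite quad /g !(rmorphB, rmorphXn, rmorph1) /= !map_polyX.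
  have -> : (1 - r5) / 2%:R + (1 + r5) / 2%:R = 1 by field.
  have -> : (1 - r5) / 2%:R * ((1 + r5) / 2%:R) = -1 by field: r5sq.
  by rewrite polyCN mul1r.
- rewrite quad.
  have -> : (1 - r5) / 2%:R + (5%:R + r5) / 2%:R = 3 by field.
  have -> : (1 - r5) / 2%:R * ((5%:R + r5) / 2%:R) = - r5 by field: r5sq.
  rewrite polyCN /f -mul_polyC !(rmorphB, rmorphXn, rmorphM) /= !map_polyX !map_polyC /=.
  by rewrite rmorph_nat.
(* Only the entries of C and D matter from here on. *)
clearbody C D; case: entC entD => C00 C01 C10 C11 [D00 D01 D10 D11] [B basisB].
have genA X : gen_subalg [set C; D] X -> ED_span X.
  apply: (@smallest_sub _ _ _ [set X | ED_span X]) ED_span_subalg _ X.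
  by move=> X [->|->]; [exists 1, 0|exists 0, 0];
     rewrite /= ?(C00, C01, C10, C11) ?(D00, D01, D10, D11); split; ring.
have memE : gen_subalg [set C; D] (C - D).
  move=> S [[S1 SZ SM] CDS].
  have SC : C \in S by rewrite in_setE; apply: CDS; left.
  have SD : D \in S by rewrite in_setE; apply: CDS; right.
  by rewrite -in_setE -[- D]scaleN1r addrC SZ.
have memDE : gen_subalg [set C; D] (D * (C - D)).
  move=> S SP; have SE : S (C - D) := memE S SP; case: SP => [[S1 SZ SM] CDS].
  rewrite -in_setE; apply: SM; rewrite in_setE //.
  by apply: CDS; right.
have rel : (sqrt5 + 1) *: (C - D) = 2 *: (D * (C - D)).
  have ord2 (i : 'I_2) : i = 0 \/ i = 1.
    by case: i => -[|[]] // lti; [left|right]; apply: val_inj.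
  apply/matrixP => i j; rewrite -mulmxE [LHS]mxE [RHS]mxE mulmx2E !mxE.
  case: (ord2 i) (ord2 j) => -> [] ->;
    rewrite ?(C00, C01, C10, C11) ?(D00, D01, D10, D11); ring: sqrt5_sq.
have [s [w [v [sA Esum wv]]]] := basis_common_ratio basisB memE memDE rel.
(* On [ED_span], m X is the part 2 p + (sqrt5 + 1) q of the lower right entry of X. *)
pose m (X : 'M[Zsqrt5]_2) := X 1 1 - X 0 0 - X 1 0.
have mE : \sum_(b <- s) w b * m b = 2.
  transitivity (m (C - D)).
    rewrite Esum /m !summxE -!sumrB; apply: eq_bigr => b _.
    by rewrite !mxE !mulrBr.
  by rewrite /m !mxE ?(C00, C01, C10, C11) ?(D00, D01, D10, D11); ring.
have [u Pu mu] : exists2 u, in_P u & \sum_(b <- s) w b * m b = 2 * u.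
  rewrite big_seq; elim/big_ind: _ => [|x y [u Pu ->] [u' Pu' ->]|b bs].
  - by exists 0; [exists 0, 0|]; ring.
  - exists (u + u'); last by ring.
    by case: Pu Pu' => [p [q ->]] [p' [q' ->]]; exists (p + p'), (q + q'); ring.
  apply: in_P_mul; first exact: in_P_ratio (wv b bs).
  have [p [q [_ e]]] := genA b (sA b bs).
  by exists p, q; rewrite /m e; ring.
apply: one_notin_P; suff -> : 1 = u by [].
apply: (@mulfI _ (2 : Zsqrt5)); last by rewrite -mu mE mulr1.
by apply/eqP => e; have /Zsqrt5_int_inj : 2%:~R = 0%:~R :> Zsqrt5.
Qed.
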